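(* Let $a\in(0,1)$ and let $g\in C^1([0,1])$ be a bistable nonlinearity, i.e. $g(0)=g(a)=g(1)=0$ and there are $0<a_1<a<a_2<1$ such that $g'(u)<0$ for $u\in[0,a_1)\cup(a_2,1]$ and $g'(u)>0$ for $u\in(a_1,a_2)$. Then for every sufficiently small $d>0$ (i.e. there is $d_0>0$ depending on $g$ such that for all $d\in(0,d_0)$) there are, up to a translation, exactly two increasing stationary fronts $\bar u,\hat u$, i.e. sequences $u=(u_i)_{i\in\mathbb Z}$ satisfying $$d(u_{i-1}-2u_i+u_{i+1})+g(u_i)=0\quad\text{for all } i\in\mathbb Z,$$ $$\lim_{i\to-\infty}u_i=0,\qquad \lim_{i\to\infty}u_i=1,\qquad u_i\le u_{i+1}\ \text{ for all } i\in\mathbb Z.$$ Furthermore, the front $\bar u$ corresponds to the symbolic sequence $\bar s=(\ldots000111\ldots)$ (or its shifts) and satisfies $\bar u_i\in[0,a_1)\cup(a_2,1]$ for all $i\in\mathbb Z$. Similarly, the front $\hat u$ corresponds to the symbolic sequence $\hat s=(\ldots000a11\ldots)$ (or its shifts; exactly one letter $a$, preceded only by $0$'s and followed only by $1$'s) and satisfies $\hat u_i\in(a_1,a_2)$ for exactly one $i\in\mathbb Z$, namely the one with $\hat s_i=a$.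
   Context: Sequences have values in $[0,1]$. A translation of $u=(u_i)$ is a sequence $(u_{i+k})_{i\in\mathbb Z}$ with $k\in\mathbb Z$; ''exactly two up to a translation'' means that there are exactly two equivalence classes of solutions modulo translations. Correspondence with symbolic sequences. Put $Q=[0,1]^2$ and $h(u)=2u-\frac1d g(u)$. For $d$ sufficiently small, each of the equations $h(u)=0$, $h(u)=1$, $h(u)=2$ has exactly three roots in $[0,1]$: $\mathrm u_0<\mathrm u_5<\mathrm u_6$ for $h=0$, $\mathrm u_1<\mathrm u_4<\mathrm u_7$ for $h=1$, $\mathrm u_2<\mathrm u_3<\mathrm u_8$ for $h=2$, and $0=\mathrm u_0<\mathrm u_1<\dots<\mathrm u_8=1$. Define the horizontal strips $$U_0=\{(x,y)\in Q:\ y\in[0,\mathrm u_2],\ 0\le h(y)-x\le1\},$$ $$U_a=\{(x,y)\in Q:\ y\in[\mathrm u_3,\mathrm u_5],\ 0\le h(y)-x\le1\},$$ $$U_1=\{(x,y)\in Q:\ y\in[\mathrm u_6,1],\ 0\le h(y)-x\le1\}.$$ A stationary solution $u=(u_i)$ corresponds to $s=(s_i)_{i\in\mathbb Z}\in\Sigma_3=\{0,a,1\}^{\mathbb Z}$ if $(u_{i+1},u_i)\in U_{s_i}$ for all $i\in\mathbb Z$. *)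

(* Defs.v *)
From Stdlib Require Import Reals ZArith Lra Lia.
Open Scope R_scope.

Definition unit_interval (x : R) : Prop := 0 <= x <= 1.

(* [D_in] and [continue_in] take limits within the domain, so the derivatives
   at 0 and 1 are one-sided and the values of [g] outside [0,1] are irrelevant. *)
Definition C1_unit (g g' : R -> R) : Prop :=
  forall x, unit_interval x ->
    D_in g g' unit_interval x /\ continue_in g' unit_interval x.

Definition bistable (a a1 a2 : R) (g g' : R -> R) : Prop :=
  C1_unit g g' /\
  (g 0 = 0 /\ g a = 0 /\ g 1 = 0) /\
  (0 < a1 /\ a1 < a /\ a < a2 /\ a2 < 1) /\
  (forall u, 0 <= u < a1 \/ a2 < u <= 1 -> g' u < 0) /\
  (forall u, a1 < u < a2 -> 0 < g' u).

Definition translation_of {A : Type} (u v : Z -> A) : Prop :=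
  exists k : Z, forall i : Z, v i = u (i + k)%Z.

Definition stationary (g : R -> R) (d : R) (u : Z -> R) : Prop :=
  (forall i : Z, 0 <= u i <= 1) /\
  (forall i : Z, d * (u (i - 1)%Z - 2 * u i + u (i + 1)%Z) + g (u i) = 0).

Definition increasing_front (g : R -> R) (d : R) (u : Z -> R) : Prop :=
  stationary g d u /\
  Un_cv (fun n : nat => u (- Z.of_nat n)%Z) 0 /\
  Un_cv (fun n : nat => u (Z.of_nat n)) 1 /\
  (forall i : Z, u i <= u (i + 1)%Z).

Definition h (g : R -> R) (d u : R) : R := 2 * u - 1 / d * g u.

(* Only the values [r 0], ..., [r 8] matter. *)
Definition level_roots (g : R -> R) (d : R) (r : nat -> R) : Prop :=
  (forall u, 0 <= u <= 1 ->
     (h g d u = 0 <-> u = r 0%nat \/ u = r 5%nat \/ u = r 6%nat)) /\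
  (forall u, 0 <= u <= 1 ->
     (h g d u = 1 <-> u = r 1%nat \/ u = r 4%nat \/ u = r 7%nat)) /\
  (forall u, 0 <= u <= 1 ->
     (h g d u = 2 <-> u = r 2%nat \/ u = r 3%nat \/ u = r 8%nat)) /\
  r 0%nat = 0 /\ r 8%nat = 1 /\
  (forall k : nat, (k < 8)%nat -> r k < r (S k)).

Inductive symbol : Set := sym0 | syma | sym1.

Definition strip_range (r : nat -> R) (s : symbol) (y : R) : Prop :=
  match s with
  | sym0 => 0 <= y <= r 2%nat
  | syma => r 3%nat <= y <= r 5%nat
  | sym1 => r 6%nat <= y <= 1
  end.

Definition strip (g : R -> R) (d : R) (r : nat -> R) (s : symbol) (x y : R)
  : Prop :=
  (0 <= x <= 1 /\ 0 <= y <= 1) /\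
  strip_range r s y /\ 0 <= h g d y - x <= 1.

Definition corresponds (g : R -> R) (d : R) (r : nat -> R)
  (u : Z -> R) (s : Z -> symbol) : Prop :=
  forall i : Z, strip g d r (s i) (u (i + 1)%Z) (u i).

Definition sbar (i : Z) : symbol := if (i <? 0)%Z then sym0 else sym1.

Definition shat (i : Z) : symbol :=
  if (i <? 0)%Z then sym0 else if (i =? 0)%Z then syma else sym1.

(* Main.v *)
(** Write the equation as [u (i-1) + u (i+1) = h (u i)].  For small [d] the set
    where [0 <= h <= 2] lies in three short intervals around [0], [a] and [1];
    [h] maps each of them onto a superset of [[0,2]] and expands distances by a
    factor at least 4.  Hence the solutions with a prescribed sequence of
    intervals are the fixed points of a map that contracts the sup norm by 1/2:
    there is exactly one for each symbolic sequence.  Near [0] (and, reflected,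
    near [1]) the expansion gives [4 u_i <= u_(i-1) + u_(i+1)], which forces
    geometric decay and monotonicity of the tails.  Since [h] decreases around
    [a], an increasing solution with two consecutive terms there is constant,
    so at most one letter [a] occurs in the coding of a front. *)

Require Import Defs.
From Stdlib Require Import Reals ZArith Lra Lia.
From Stdlib Require Import ClassicalEpsilon.
Open Scope R_scope.

(** * One-variable calculus on the closed unit interval *)

(** The Stdlib forms of the mean value and intermediate value theorems take functions on all of [R].
    Composing [g] with this retraction onto [0,1] gives a continuous function on [R] that depends
    only on [g] restricted to [0,1]. *)
Definition clamp (x : R) : R := Rmax 0 (Rmin 1 x).

Lemma clamp_unit (x : R) : 0 <= clamp x <= 1.
Proof. unfold clamp, Rmax, Rmin; repeat destruct Rle_dec; lra. Qed.

Lemma clamp_id (x : R) : 0 <= x <= 1 -> clamp x = x.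
Proof. unfold clamp, Rmax, Rmin; intros; repeat destruct Rle_dec; lra. Qed.

Lemma clamp_lipschitz (x y : R) : Rabs (clamp x - clamp y) <= Rabs (x - y).
Proof.
  unfold clamp, Rmax, Rmin, Rabs; repeat destruct Rle_dec; repeat destruct Rcase_abs; lra.
Qed.

Lemma C1_unit_clamp_continuity (g g' : R -> R) :
  C1_unit g g' -> continuity (fun x => g (clamp x)).
Proof.
  intros HC x eps Heps.
  destruct (HC (clamp x) (clamp_unit x)) as [HD _].
  destruct (cont_deriv _ _ _ _ HD eps Heps) as [alp [Halp Hlim]].
  exists alp; split; [exact Halp|].
  intros y [_ Hy]; simpl in *; unfold Rdist in *.
  (* Limits within a domain exclude the base point, and [clamp] may send [y] onto it. *)
  destruct (Req_dec (clamp x) (clamp y)) as [E|E].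
  - rewrite E, Rminus_diag, Rabs_R0; lra.
  - apply Hlim; split.
    + split; [exact (clamp_unit y) | exact E].
    + eapply Rle_lt_trans; [apply clamp_lipschitz | exact Hy].
Qed.

Lemma C1_unit_derivable_pt_lim (g g' : R -> R) (x : R) :
  C1_unit g g' -> 0 < x < 1 ->
  derivable_pt_lim (fun x => g (clamp x)) x (g' x).
Proof.
  intros HC Hx eps Heps.
  destruct (HC x) as [HD _]; [unfold unit_interval; lra|].
  destruct (HD eps Heps) as [alp [Halp Hlim]]; simpl in Hlim; unfold Rdist in Hlim.
  (* This radius keeps [x + k] inside (0,1), where [clamp] is the identity. *)
  assert (Hdel : 0 < Rmin alp (Rmin x (1 - x))) by (repeat apply Rmin_glb_lt; lra).
  exists (mkposreal _ Hdel); intros k Hk Hkd; simpl in Hkd.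
  assert (Hka : Rabs k < alp) by (eapply Rlt_le_trans; [exact Hkd | apply Rmin_l]).
  assert (Hkx : Rabs k < Rmin x (1 - x)) by (eapply Rlt_le_trans; [exact Hkd | apply Rmin_r]).
  pose proof (Rmin_l x (1 - x)); pose proof (Rmin_r x (1 - x)).
  assert (Hb : - x < k < 1 - x) by (split; destruct (Rabs_def2 _ _ Hkx); lra).
  rewrite !clamp_id by lra.
  specialize (Hlim (x + k)).
  replace (x + k - x) with k in Hlim by ring.
  apply Hlim; split; [|exact Hka].
  split; [unfold unit_interval; lra | lra].
Qed.

Lemma C1_unit_mean_value (g g' : R -> R) (x y : R) :
  C1_unit g g' -> 0 <= x -> x < y -> y <= 1 ->
  exists c, x < c < y /\ g y - g x = g' c * (y - x).
Proof.
  intros HC Hx Hxy Hy.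
  set (G := fun x => g (clamp x)).
  assert (pr1 : forall c, x < c < y -> derivable_pt G c).
  { intros c Hc; exists (g' c); apply C1_unit_derivable_pt_lim; [exact HC | lra]. }
  destruct (MVT G id x y pr1 (fun c _ => derivable_pt_id c) Hxy) as [c [Hc E]].
  - intros c _; exact (C1_unit_clamp_continuity g g' HC c).
  - intros c _; apply derivable_continuous, derivable_id.
  - exists c; split; [exact Hc|].
    rewrite derive_pt_id in E.
    rewrite (derive_pt_eq_0 G c (g' c) (pr1 c Hc)) in E
      by (apply C1_unit_derivable_pt_lim; [exact HC | lra]).
    unfold G, id in E; rewrite !clamp_id in E by lra; lra.
Qed.

Lemma C1_unit_increment_le (g g' : R -> R) (K x y : R) :
  C1_unit g g' -> 0 <= x -> x <= y -> y <= 1 ->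
  (forall c, x < c < y -> g' c <= K) -> g y - g x <= K * (y - x).
Proof.
  intros HC Hx [Hxy|<-] Hy HK; [|lra].
  destruct (C1_unit_mean_value g g' x y HC Hx Hxy Hy) as [c [Hc ->]].
  apply Rmult_le_compat_r; [lra | exact (HK c Hc)].
Qed.

Lemma C1_unit_increment_ge (g g' : R -> R) (K x y : R) :
  C1_unit g g' -> 0 <= x -> x <= y -> y <= 1 ->
  (forall c, x < c < y -> K <= g' c) -> K * (y - x) <= g y - g x.
Proof.
  intros HC Hx [Hxy|<-] Hy HK; [|lra].
  destruct (C1_unit_mean_value g g' x y HC Hx Hxy Hy) as [c [Hc ->]].
  apply Rmult_le_compat_r; [lra | exact (HK c Hc)].
Qed.

Lemma C1_unit_derivative_near (g g' : R -> R) (p eps : R) :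
  C1_unit g g' -> 0 <= p <= 1 -> 0 < eps ->
  exists del, 0 < del /\
    forall x, 0 <= x <= 1 -> Rabs (x - p) < del -> Rabs (g' x - g' p) < eps.
Proof.
  intros HC Hp Heps.
  destruct (HC p Hp) as [_ Hcont].
  destruct (Hcont eps Heps) as [del [Hdel Hlim]]; simpl in Hlim; unfold Rdist in Hlim.
  exists del; split; [exact Hdel|]; intros x Hx Hxp.
  destruct (Req_dec p x) as [->|E].
  - rewrite Rminus_diag, Rabs_R0; lra.
  - apply Hlim; split; [split; [exact Hx | exact E] | exact Hxp].
Qed.

Lemma IVT_between (G : R -> R) (x y t : R) :
  continuity G -> x < y -> G x <= t <= G y \/ G y <= t <= G x ->
  exists z, x <= z <= y /\ G z = t.
Proof.
  intros HG Hxy Ht.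
  assert (Hc : continuity (fun z => G z - t))
    by (apply continuity_minus; [exact HG | apply continuity_const; intros ? ?; reflexivity]).
  destruct (IVT_cor _ x y Hc) as [z [Hz E]]; [lra | |].
  - destruct Ht as [Ht|Ht]; nra.
  - exists z; split; [exact Hz | lra].
Qed.

Lemma Rle_div_of_mul_le (c x d : R) : 0 < d -> c * d <= x -> c <= x / d.
Proof.
  intros Hd Hc; replace c with (c * d / d) by (field; lra).
  apply Rmult_le_compat_r; [apply Rlt_le, Rinv_0_lt_compat, Hd | exact Hc].
Qed.

Lemma half_pow_pos (n : nat) : 0 < (1 / 2) ^ n.
Proof. apply pow_lt; lra. Qed.

Lemma half_pow_small (eps : R) : 0 < eps -> exists N, forall n, (N <= n)%nat -> (1 / 2) ^ n < eps.
Proof.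
  intros Heps.
  destruct (pow_lt_1_zero (1 / 2)) with (y := eps) as [N HN];
    [rewrite Rabs_pos_eq; lra | exact Heps |].
  exists N; intros n Hn; specialize (HN n Hn).
  pose proof (half_pow_pos n); rewrite Rabs_pos_eq in HN; lra.
Qed.

Lemma le_of_half_pow (x y : R) : (forall n, x <= y + (1 / 2) ^ n) -> x <= y.
Proof.
  intros H; destruct (Rle_lt_dec x y) as [|Hlt]; [assumption|].
  destruct (half_pow_small (x - y)) as [N HN]; [lra|].
  specialize (HN N (le_n N)); specialize (H N); lra.
Qed.

(** * Expanding branches and their symbolic dynamics *)

(** The sign of the slope of [H] on each branch. *)
Definition orientation (s : symbol) : R := match s with syma => -1 | _ => 1 end.

(** All that the symbolic dynamics uses of [h], freed from [g] and [d]; [phi s] is the inverse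
    branch of [H] over [0,2]. The factor 4 is chosen against the two neighbours in the equation: it
    gives the contraction ratio 2/4. *)
Record expanding_branches (H : R -> R) (lo hi : symbol -> R)
    (phi : symbol -> R -> R) : Prop := {
  eb_lo0 : lo sym0 = 0;
  eb_gap0 : hi sym0 < lo syma;
  eb_gap1 : hi syma < lo sym1;
  eb_hi1 : hi sym1 = 1;
  eb_cover : forall u, 0 <= u <= 1 -> 0 <= H u <= 2 ->
    exists s, lo s <= u <= hi s;
  eb_expand : forall s x y, lo s <= x -> x <= y -> y <= hi s ->
    4 * (y - x) <= orientation s * (H y - H x);
  eb_phi : forall s t, 0 <= t <= 2 ->
    lo s <= phi s t <= hi s /\ H (phi s t) = t;
  eb_H0 : H 0 = 0;
  eb_H1 : H 1 = 2
}.

(** The stationary equation solved for [u i], as a fixed point equation. The bounds keep the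
    argument of [phi] in [0,2], where it inverts [H]. *)
Definition coded (phi : symbol -> R -> R) (s : Z -> symbol) (u : Z -> R) : Prop :=
  forall i, 0 <= u i <= 1 /\ u i = phi (s i) (u (i - 1)%Z + u (i + 1)%Z).

Section Branches.

Context (H : R -> R) (lo hi : symbol -> R) (phi : symbol -> R -> R).
Context (EB : expanding_branches H lo hi phi).

Let lo0 := eb_lo0 _ _ _ _ EB.
Let gap0 := eb_gap0 _ _ _ _ EB.
Let gap1 := eb_gap1 _ _ _ _ EB.
Let hi1 := eb_hi1 _ _ _ _ EB.

Lemma branch_lo_le_hi (s : symbol) : lo s <= hi s.
Proof. destruct (eb_phi _ _ _ _ EB s 0); lra. Qed.

Lemma branch_unit (s : symbol) (x : R) : lo s <= x <= hi s -> 0 <= x <= 1.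
Proof.
  pose proof (branch_lo_le_hi sym0); pose proof (branch_lo_le_hi syma);
  pose proof (branch_lo_le_hi sym1).
  destruct s; lra.
Qed.

Lemma branch_dist (s : symbol) (x y : R) :
  lo s <= x <= hi s -> lo s <= y <= hi s -> 4 * Rabs (x - y) <= Rabs (H x - H y).
Proof.
  enough (Hw : forall x y, lo s <= x -> x <= y -> y <= hi s ->
                 4 * Rabs (x - y) <= Rabs (H x - H y)).
  { intros Hx Hy; destruct (Rle_dec x y); [apply Hw; lra|].
    rewrite Rabs_minus_sym, (Rabs_minus_sym (H x)); apply Hw; lra. }
  clear x y; intros x y Hx Hxy Hy.
  pose proof (eb_expand _ _ _ _ EB s x y Hx Hxy Hy) as He.
  unfold Rabs; destruct s; simpl in He; repeat destruct Rcase_abs; lra.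
Qed.

Lemma branch_inverse_unique (s : symbol) (x t : R) :
  0 <= t <= 2 -> lo s <= x <= hi s -> H x = t -> x = phi s t.
Proof.
  intros Ht Hx E.
  destruct (eb_phi _ _ _ _ EB s t Ht) as [Hp Ep].
  pose proof (branch_dist s x (phi s t) Hx Hp) as Hd.
  rewrite E, Ep, Rminus_diag, Rabs_R0 in Hd.
  pose proof (Rabs_pos (x - phi s t)).
  apply Rminus_diag_uniq; destruct (Req_dec (x - phi s t) 0) as [|Hn]; [assumption|].
  pose proof (Rabs_pos_lt _ Hn); lra.
Qed.

Lemma branch_inverse_dist (s : symbol) (t t' : R) :
  0 <= t <= 2 -> 0 <= t' <= 2 -> 4 * Rabs (phi s t - phi s t') <= Rabs (t - t').
Proof.
  intros Ht Ht'.
  destruct (eb_phi _ _ _ _ EB s t Ht) as [Hp Ep].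
  destruct (eb_phi _ _ _ _ EB s t' Ht') as [Hp' Ep'].
  rewrite <- Ep at 2; rewrite <- Ep' at 2; apply (branch_dist s); assumption.
Qed.

(** The sum of the two neighbours moves by at most [2 * M], and the inverse branch divides this by
    4. *)
Lemma branch_inverse_step (s : symbol) (x x' y y' M : R) :
  0 <= x <= 1 -> 0 <= x' <= 1 -> 0 <= y <= 1 -> 0 <= y' <= 1 ->
  Rabs (x - x') <= M -> Rabs (y - y') <= M ->
  Rabs (phi s (x + y) - phi s (x' + y')) <= 1 / 2 * M.
Proof.
  intros Hx Hx' Hy Hy' HM HM'.
  pose proof (branch_inverse_dist s (x + y) (x' + y') ltac:(lra) ltac:(lra)).
  pose proof (Rabs_triang (x - x') (y - y')) as Ht.
  replace (x - x' + (y - y')) with (x + y - (x' + y')) in Ht by ring; lra.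
Qed.

(** Both sequences are fixed points of the same contraction. Their distance is at most 1 at the
    start, and each use of the equation halves the bound. *)
Lemma coded_unique (s : Z -> symbol) (u v : Z -> R) :
  coded phi s u -> coded phi s v -> forall i, u i = v i.
Proof.
  intros Hu Hv.
  assert (Hn : forall n i, Rabs (u i - v i) <= (1 / 2) ^ n).
  { induction n as [|n IH]; intros i.
    - destruct (Hu i), (Hv i); simpl; apply Rabs_le; lra.
    - destruct (Hu i) as [_ ->], (Hv i) as [_ ->].
      apply branch_inverse_step; try apply Hu; try apply Hv; apply IH. }
  intros i.
  assert (Rabs (u i - v i) <= 0)
    by (apply le_of_half_pow; intros n; specialize (Hn n i); lra).
  destruct (Req_dec (u i - v i) 0) as [|E]; [lra|].
  pose proof (Rabs_pos_lt _ E); lra.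
Qed.

(** The Picard iterates of the contraction, started from the zero sequence. *)
Fixpoint coded_iter (s : Z -> symbol) (n : nat) (i : Z) : R :=
  match n with
  | O => 0
  | S n => phi (s i) (coded_iter s n (i - 1)%Z + coded_iter s n (i + 1)%Z)
  end.

Lemma coded_iter_unit (s : Z -> symbol) (n : nat) (i : Z) : 0 <= coded_iter s n i <= 1.
Proof.
  revert i; induction n as [|n IH]; intros i; simpl; [lra|].
  apply (branch_unit (s i)), (eb_phi _ _ _ _ EB).
  pose proof (IH (i - 1)%Z); pose proof (IH (i + 1)%Z); lra.
Qed.

Lemma coded_iter_dist (s : Z -> symbol) (n k : nat) (i : Z) :
  Rabs (coded_iter s (n + k) i - coded_iter s n i) <= (1 / 2) ^ n.
Proof.
  revert i; induction n as [|n IH]; intros i.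
  - pose proof (coded_iter_unit s k i); simpl; apply Rabs_le; lra.
  - simpl; apply branch_inverse_step; auto using coded_iter_unit.
Qed.

(** The iterates converge pointwise, with an error bound uniform in [i]; so the neighbours of each
    site converge at the same rate, and the fixed point equation passes to the limit. *)
Lemma coded_exists (s : Z -> symbol) : exists u, coded phi s u.
Proof.
  assert (HC : forall i, Cauchy_crit (fun n => coded_iter s n i)).
  { intros i eps Heps.
    destruct (half_pow_small (eps / 2)) as [N HN]; [lra|].
    exists N; intros n m Hn Hm; unfold Rdist.
    pose proof (coded_iter_dist s N (n - N) i) as H1.
    pose proof (coded_iter_dist s N (m - N) i) as H2.
    replace (N + (n - N))%nat with n in H1 by lia.
    replace (N + (m - N))%nat with m in H2 by lia.
    pose proof (Rdist_tri (coded_iter s n i) (coded_iter s m i) (coded_iter s N i)) as H3.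
    unfold Rdist in H3; rewrite (Rabs_minus_sym (coded_iter s N i)) in H3.
    specialize (HN N (le_n N)); lra. }
  set (u := fun i => proj1_sig (R_complete _ (HC i))).
  assert (Hu : forall n i, Rabs (u i - coded_iter s n i) <= (1 / 2) ^ n).
  { intros n i; apply le_of_half_pow; intros m.
    unfold u; destruct (R_complete _ (HC i)) as [l Hl]; simpl.
    destruct (Hl _ (half_pow_pos m)) as [N HN].
    (* The index [n + N] is past the threshold [N] and also has the form required by
       [coded_iter_dist]. *)
    specialize (HN (n + N)%nat ltac:(lia)); unfold Rdist in HN.
    pose proof (coded_iter_dist s n N i).
    pose proof (Rdist_tri l (coded_iter s n i) (coded_iter s (n + N) i)) as Ht.
    unfold Rdist in Ht; rewrite (Rabs_minus_sym l (coded_iter s (n + N) i)) in Ht; lra. }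
  assert (Hunit : forall i, 0 <= u i <= 1).
  { intros i; split; apply le_of_half_pow; intros n;
      specialize (Hu n i); pose proof (coded_iter_unit s n i);
      unfold Rabs in Hu; destruct Rcase_abs; lra. }
  exists u; intros i; split; [apply Hunit|].
  set (t := phi (s i) (u (i - 1)%Z + u (i + 1)%Z)).
  (* The iterate of order [S n] is within half of [(1 / 2) ^ n] both of [u i] and of [t]. *)
  assert (Hd : forall n, Rabs (u i - t) <= (1 / 2) ^ n).
  { intros n.
    assert (H1 : Rabs (coded_iter s (S n) i - t) <= 1 / 2 * (1 / 2) ^ n).
    { simpl; apply branch_inverse_step; auto using coded_iter_unit;
        rewrite Rabs_minus_sym; apply Hu. }
    pose proof (Hu (S n) i) as H2; change ((1 / 2) ^ S n) with (1 / 2 * (1 / 2) ^ n) in H2.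
    pose proof (Rdist_tri (u i) t (coded_iter s (S n) i)) as H3; unfold Rdist in H3; lra. }
  assert (Rabs (u i - t) <= 0)
    by (apply le_of_half_pow; intros n; specialize (Hd n); lra).
  destruct (Req_dec (u i - t) 0) as [|E]; [lra|].
  pose proof (Rabs_pos_lt _ E); lra.
Qed.

Lemma coded_equation (s : Z -> symbol) (u : Z -> R) :
  coded phi s u ->
  forall i, lo (s i) <= u i <= hi (s i) /\ H (u i) = u (i - 1)%Z + u (i + 1)%Z.
Proof.
  intros Hu i.
  destruct (Hu (i - 1)%Z) as [H1 _], (Hu (i + 1)%Z) as [H2 _], (Hu i) as [_ E].
  destruct (eb_phi _ _ _ _ EB (s i) (u (i - 1)%Z + u (i + 1)%Z)) as [H3 H4]; [lra|].
  rewrite <- E in H3, H4; auto.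
Qed.

Lemma equation_coded (s : Z -> symbol) (u : Z -> R) :
  (forall i, lo (s i) <= u i <= hi (s i)) ->
  (forall i, H (u i) = u (i - 1)%Z + u (i + 1)%Z) -> coded phi s u.
Proof.
  intros Hs Hu.
  assert (Hunit : forall i, 0 <= u i <= 1) by (intros i; apply (branch_unit (s i)), Hs).
  intros i; split; [apply Hunit|].
  apply branch_inverse_unique; auto.
  pose proof (Hunit (i - 1)%Z); pose proof (Hunit (i + 1)%Z); lra.
Qed.

Lemma branch0_growth (x : R) : lo sym0 <= x <= hi sym0 -> 4 * x <= H x.
Proof.
  intros Hx.
  pose proof (eb_expand _ _ _ _ EB sym0 0 x) as He.
  rewrite (eb_H0 _ _ _ _ EB) in He; simpl in He; lra.
Qed.

Lemma branch1_growth (x : R) : lo sym1 <= x <= hi sym1 -> 4 * (1 - x) <= 2 - H x.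
Proof.
  intros Hx.
  pose proof (eb_expand _ _ _ _ EB sym1 x 1) as He.
  rewrite (eb_H1 _ _ _ _ EB) in He; simpl in He; lra.
Qed.

End Branches.

(** * Tails *)

(** Both neighbours of a site at depth [S n] have depth at least [n], so 4 v_i is at most twice the
    previous bound. *)
Lemma tail_decay (v : Z -> R) :
  (forall i, 0 <= v i <= 1) ->
  (forall i, (i < 0)%Z -> 4 * v i <= v (i - 1)%Z + v (i + 1)%Z) ->
  forall n i, (i <= - Z.of_nat n)%Z -> v i <= (1 / 2) ^ n.
Proof.
  intros Hv Hg; induction n as [|n IH]; intros i Hi.
  - simpl; apply Hv.
  - pose proof (Hg i ltac:(lia)).
    pose proof (IH (i - 1)%Z ltac:(lia)); pose proof (IH (i + 1)%Z ltac:(lia)).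
    simpl; lra.
Qed.

Lemma tail_cv (v : Z -> R) :
  (forall i, 0 <= v i <= 1) ->
  (forall i, (i < 0)%Z -> 4 * v i <= v (i - 1)%Z + v (i + 1)%Z) ->
  Un_cv (fun n => v (- Z.of_nat n)%Z) 0.
Proof.
  intros Hv Hg eps Heps.
  destruct (half_pow_small eps Heps) as [N HN].
  exists N; intros n Hn; unfold Rdist.
  pose proof (Hv (- Z.of_nat n)%Z); specialize (HN n Hn).
  pose proof (tail_decay v Hv Hg n (- Z.of_nat n)%Z ltac:(lia)).
  rewrite Rabs_pos_eq; lra.
Qed.

(* A descent [v (i+1) < v i] would propagate to the left, against the decay. *)
Lemma tail_monotone (v : Z -> R) :
  (forall i, 0 <= v i <= 1) ->
  (forall i, (i < 0)%Z -> 4 * v i <= v (i - 1)%Z + v (i + 1)%Z) ->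
  forall i, (i < 0)%Z -> v i <= v (i + 1)%Z.
Proof.
  intros Hv Hg i Hi.
  destruct (Rle_lt_dec (v i) (v (i + 1)%Z)) as [|Hlt]; [assumption|].
  assert (Hk : forall k : nat, v i <= v (i - Z.of_nat k)%Z /\
                 v (i - Z.of_nat k + 1)%Z < v (i - Z.of_nat k)%Z).
  { induction k as [|k [IH1 IH2]].
    - rewrite Z.sub_0_r; lra.
    (* At j = i - k, the descent v_(j+1) < v_j turns the growth inequality into v_(j-1) > 3 v_j,
       which is at least v_j. *)
    - pose proof (Hg (i - Z.of_nat k)%Z ltac:(lia)) as Hc.
      pose proof (Hv (i - Z.of_nat k)%Z).
      replace (i - Z.of_nat (S k) + 1)%Z with (i - Z.of_nat k)%Z by lia.
      replace (i - Z.of_nat (S k))%Z with (i - Z.of_nat k - 1)%Z by lia; lra. }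
  assert (v i <= 0).
  { apply le_of_half_pow; intros n.
    pose proof (tail_decay v Hv Hg n (i - Z.of_nat n)%Z ltac:(lia)).
    destruct (Hk n); lra. }
  pose proof (Hv (i + 1)%Z); lra.
Qed.

(** The symbol at 0 is left free, so that one argument serves both [sbar] and [shat]. *)
Lemma coded_front (H : R -> R) (lo hi : symbol -> R) (phi : symbol -> R -> R)
    (s : Z -> symbol) (u : Z -> R) :
  expanding_branches H lo hi phi -> coded phi s u ->
  (forall i, (i < 0)%Z -> s i = sym0) -> (forall i, (0 < i)%Z -> s i = sym1) ->
  Un_cv (fun n => u (- Z.of_nat n)%Z) 0 /\
  Un_cv (fun n => u (Z.of_nat n)) 1 /\
  (forall i, u i <= u (i + 1)%Z).
Proof.
  intros EB Hu Hs0 Hs1.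
  assert (Hunit : forall i, 0 <= u i <= 1) by apply Hu.
  assert (Hg0 : forall i, (i < 0)%Z -> 4 * u i <= u (i - 1)%Z + u (i + 1)%Z).
  { intros i Hi; destruct (coded_equation _ _ _ _ EB s u Hu i) as [Hr <-].
    rewrite Hs0 in Hr by exact Hi; exact (branch0_growth _ _ _ _ EB _ Hr). }
  (* The reflection exchanges the ends 0 and 1, so that the right tail becomes a left tail. *)
  set (v := fun i => 1 - u (- i)%Z).
  assert (Hv : forall i, 0 <= v i <= 1)
    by (intros i; unfold v; pose proof (Hunit (- i)%Z); lra).
  assert (Hg1 : forall i, (i < 0)%Z -> 4 * v i <= v (i - 1)%Z + v (i + 1)%Z).
  { intros i Hi; unfold v.
    destruct (coded_equation _ _ _ _ EB s u Hu (- i)%Z) as [Hr He].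
    rewrite Hs1 in Hr by lia.
    pose proof (branch1_growth _ _ _ _ EB _ Hr).
    replace (- (i - 1))%Z with (- i + 1)%Z by lia.
    replace (- (i + 1))%Z with (- i - 1)%Z by lia; lra. }
  split; [exact (tail_cv u Hunit Hg0)|split].
  - intros eps Heps; destruct (tail_cv v Hv Hg1 eps Heps) as [N HN].
    exists N; intros n Hn; specialize (HN n Hn); unfold Rdist, v in *.
    rewrite Z.opp_involutive in HN; rewrite Rabs_minus_sym.
    rewrite Rminus_0_r in HN; exact HN.
  - intros i; destruct (Z_lt_dec i 0) as [Hi|Hi]; [exact (tail_monotone u Hunit Hg0 i Hi)|].
    (* For [i >= 0] the pair [i], [i + 1] is reflected to the pair starting at [- (i + 1)], which is
       negative. *)
    pose proof (tail_monotone v Hv Hg1 (- (i + 1))%Z ltac:(lia)) as Hm; unfold v in Hm.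
    replace (- (- (i + 1) + 1))%Z with i in Hm by lia.
    rewrite Z.opp_involutive in Hm; lra.
Qed.

(** * Coding of monotone solutions *)

Lemma Z_switch (P : Z -> Prop) (p : Z) (n : nat) :
  P p -> ~ P (p + Z.of_nat n)%Z -> exists m, P m /\ ~ P (m + 1)%Z.
Proof.
  revert p; induction n as [|n IH]; intros p Hp Hn.
  - rewrite Z.add_0_r in Hn; contradiction.
  - destruct (classic (P (p + 1)%Z)) as [Hp1|Hp1]; [|exists p; auto].
    apply (IH (p + 1)%Z Hp1).
    replace (p + 1 + Z.of_nat n)%Z with (p + Z.of_nat (S n))%Z by lia; exact Hn.
Qed.

Lemma monotone_Z (u : Z -> R) :
  (forall i, u i <= u (i + 1)%Z) -> forall i j, (i <= j)%Z -> u i <= u j.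
Proof.
  intros Hm i j Hij.
  replace j with (i + Z.of_nat (Z.to_nat (j - i)))%Z by lia.
  induction (Z.to_nat (j - i)) as [|n IH].
  - rewrite Z.add_0_r; lra.
  - pose proof (Hm (i + Z.of_nat n)%Z).
    replace (i + Z.of_nat (S n))%Z with (i + Z.of_nat n + 1)%Z by lia; lra.
Qed.

(** Subtracting the equations at i and i+1 gives H(u_(i+1)) - H(u_i) = (u_i - u_(i-1)) + (u_(i+2) -
    u_(i+1)), which is nonnegative, while [H] decreases on the middle branch. Hence u_(i+1) = u_i
    with H(u_i) = 2 u_i, and the recurrence continues this constant to the right. *)
Lemma monotone_consecutive_middle (H : R -> R) (lo hi : symbol -> R)
    (phi : symbol -> R -> R) (u : Z -> R) (i : Z) :
  expanding_branches H lo hi phi ->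
  (forall i, H (u i) = u (i - 1)%Z + u (i + 1)%Z) ->
  (forall i, u i <= u (i + 1)%Z) ->
  lo syma <= u i <= hi syma -> lo syma <= u (i + 1)%Z <= hi syma ->
  forall n, u (i + Z.of_nat n)%Z = u i.
Proof.
  intros EB He Hm Hi Hi1.
  pose proof (Hm i) as M1.
  pose proof (Hm (i - 1)%Z) as M0; replace (i - 1 + 1)%Z with i in M0 by lia.
  pose proof (Hm (i + 1)%Z) as M2.
  pose proof (He i) as E0.
  pose proof (He (i + 1)%Z) as E1; replace (i + 1 - 1)%Z with i in E1 by lia.
  pose proof (eb_expand _ _ _ _ EB syma (u i) (u (i + 1)%Z)
                (proj1 Hi) M1 (proj2 Hi1)) as Hx; simpl in Hx.
  assert (Eq : u (i + 1)%Z = u i) by lra.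
  assert (Hc : H (u i) = 2 * u i) by (rewrite Eq in E1; lra).
  enough (Hn : forall n, u (i + Z.of_nat n)%Z = u i /\ u (i + Z.of_nat n + 1)%Z = u i)
    by (intros n; apply Hn).
  induction n as [|n [IH1 IH2]].
  - rewrite Z.add_0_r; auto.
  - replace (i + Z.of_nat (S n))%Z with (i + Z.of_nat n + 1)%Z by lia.
    split; [exact IH2|].
    pose proof (He (i + Z.of_nat n + 1)%Z) as En.
    replace (i + Z.of_nat n + 1 - 1)%Z with (i + Z.of_nat n)%Z in En by lia.
    rewrite IH2, IH1 in En; lra.
Qed.

Lemma monotone_front_coding (H : R -> R) (lo hi : symbol -> R)
    (phi : symbol -> R -> R) (u : Z -> R) :
  expanding_branches H lo hi phi ->
  (forall i, 0 <= u i <= 1) ->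
  (forall i, H (u i) = u (i - 1)%Z + u (i + 1)%Z) ->
  Un_cv (fun n => u (- Z.of_nat n)%Z) 0 ->
  Un_cv (fun n => u (Z.of_nat n)) 1 ->
  (forall i, u i <= u (i + 1)%Z) ->
  exists m, coded phi sbar (fun i => u (i + m)%Z) \/
            coded phi shat (fun i => u (i + m)%Z).
Proof.
  intros EB Hunit He L0 L1 Hm.
  pose proof (branch_lo_le_hi _ _ _ _ EB) as Hlh.
  pose proof (Hlh sym0); pose proof (Hlh syma); pose proof (Hlh sym1).
  pose proof (eb_lo0 _ _ _ _ EB); pose proof (eb_gap0 _ _ _ _ EB).
  pose proof (eb_gap1 _ _ _ _ EB); pose proof (eb_hi1 _ _ _ _ EB).
  assert (Hcov : forall i, exists s, lo s <= u i <= hi s).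
  { intros i; apply (eb_cover _ _ _ _ EB); [apply Hunit|].
    rewrite He; pose proof (Hunit (i - 1)%Z); pose proof (Hunit (i + 1)%Z); lra. }
  pose proof (monotone_Z u Hm) as Hmono.
  (* A term below [lo syma] can only lie in the left cell; a term above [hi syma] has passed the
     middle one. *)
  destruct (L0 (lo syma)) as [N0 HN0]; [lra|].
  destruct (L1 (1 - hi syma)) as [N1 HN1]; [lra|].
  assert (Hleft : u (- Z.of_nat N0)%Z <= hi sym0).
  { specialize (HN0 N0 ltac:(lia)); unfold Rdist in HN0.
    destruct (Rabs_def2 _ _ HN0).
    destruct (Hcov (- Z.of_nat N0)%Z) as [[] ?]; lra. }
  assert (Hright : hi syma < u (Z.of_nat N1)).
  { specialize (HN1 N1 ltac:(lia)); unfold Rdist in HN1.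
    destruct (Rabs_def2 _ _ HN1); lra. }
  destruct (Z_switch (fun i => u i <= hi sym0) (- Z.of_nat N0)%Z (N0 + N1)) as [k [Hk Hk1]].
  { exact Hleft. }
  { replace (- Z.of_nat N0 + Z.of_nat (N0 + N1))%Z with (Z.of_nat N1) by lia; lra. }
  assert (Hneg : forall i, (i < 0)%Z -> lo sym0 <= u (i + (k + 1))%Z <= hi sym0).
  { intros i Hi; pose proof (Hmono (i + (k + 1))%Z k ltac:(lia)).
    pose proof (Hunit (i + (k + 1))%Z); lra. }
  assert (Hshift : forall i, H (u (i + (k + 1))%Z) =
                     u (i - 1 + (k + 1))%Z + u (i + 1 + (k + 1))%Z).
  { intros i; rewrite He; f_equal; f_equal; lia. }
  (* Here [k] is the last index in the left cell. The shift moves the first term outside it to 0,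
     and the cell of that term decides between [shat] and [sbar]. *)
  exists (k + 1)%Z.
  destruct (Hcov (k + 1)%Z) as [[] Hs]; [lra | right | left];
    apply (equation_coded _ _ _ _ EB); try exact Hshift; intros i.
  - unfold shat; destruct (Z.ltb_spec i 0) as [Hi|Hi]; [apply Hneg, Hi|].
    destruct (Z.eqb_spec i 0) as [->|Hi0]; [exact Hs|].
    (* Otherwise two consecutive terms lie in the middle cell, and the sequence stays constant
       there, although it exceeds [hi syma] at [N1]. If [N1] precedes [k + 1], [Z.to_nat] yields 0
       and monotonicity still gives the contradiction. *)
    assert (Hnext : hi syma < u (k + 1 + 1)%Z).
    { destruct (Rle_lt_dec (u (k + 1 + 1)%Z) (hi syma)) as [Hle|]; [exfalso|assumption].
      pose proof (Hm (k + 1)%Z).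
      pose proof (monotone_consecutive_middle _ _ _ _ u (k + 1)%Z EB He Hm Hs
                    ltac:(lra)) as Hconst.
      specialize (Hconst (Z.to_nat (Z.of_nat N1 - (k + 1)))).
      pose proof (Hmono (Z.of_nat N1)
        (k + 1 + Z.of_nat (Z.to_nat (Z.of_nat N1 - (k + 1))))%Z ltac:(lia)); lra. }
    pose proof (Hmono (k + 1 + 1)%Z (i + (k + 1))%Z ltac:(lia)).
    destruct (Hcov (i + (k + 1))%Z) as [[] ?]; lra.
  - unfold sbar; destruct (Z.ltb_spec i 0) as [Hi|Hi]; [apply Hneg, Hi|].
    pose proof (Hmono (k + 1)%Z (i + (k + 1))%Z ltac:(lia)).
    pose proof (Hunit (i + (k + 1))%Z); lra.
Qed.

(** * The branches of [h] for small [d] *)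

(** The cells are the same for all small [d], unlike the intervals bounded by the level roots, which
    they contain. *)
Definition cell_lo (a del : R) (s : symbol) : R :=
  match s with sym0 => 0 | syma => a - del | sym1 => 1 - del end.

Definition cell_hi (a del : R) (s : symbol) : R :=
  match s with sym0 => del | syma => a + del | sym1 => 1 end.

(** The slope of [g] is nonzero at its three zeros, and continuity of [g'] keeps it away from 0 on
    small cells around them. *)
Lemma bistable_slopes (a a1 a2 : R) (g g' : R -> R) :
  bistable a a1 a2 g g' ->
  exists del m, 0 < del /\ 0 < m /\
    del < a1 /\ del < a - a1 /\ del < a2 - a /\ del < 1 - a2 /\
    (forall x, 0 <= x <= del -> g' x <= - m) /\
    (forall x, a - del <= x <= a + del -> m <= g' x) /\
    (forall x, 1 - del <= x <= 1 -> g' x <= - m).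
Proof.
  intros [HC [_ [Ha [Hneg Hpos]]]].
  pose proof (Hneg 0 ltac:(lra)) as G0.
  pose proof (Hpos a ltac:(lra)) as Ga.
  pose proof (Hneg 1 ltac:(lra)) as G1.
  (* Of the slope [2 * m] at each zero, [m] is given up to the oscillation of [g'] over the cell. *)
  assert (Hm : exists m, 0 < m /\ 2 * m <= - g' 0 /\ 2 * m <= g' a /\ 2 * m <= - g' 1).
  { exists (Rmin (- g' 0) (Rmin (g' a) (- g' 1)) / 2).
    unfold Rmin; repeat destruct Rle_dec; lra. }
  destruct Hm as [m [Hm [M0 [Ma M1]]]].
  destruct (C1_unit_derivative_near g g' 0 m HC ltac:(lra) Hm) as [e0 [He0 D0]].
  destruct (C1_unit_derivative_near g g' a m HC ltac:(lra) Hm) as [ea [Hea Da]].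
  destruct (C1_unit_derivative_near g g' 1 m HC ltac:(lra) Hm) as [e1 [He1 D1]].
  assert (Hdel : exists del, 0 < del /\ del < e0 /\ del < ea /\ del < e1 /\
            del < a1 /\ del < a - a1 /\ del < a2 - a /\ del < 1 - a2).
  { exists (Rmin e0 (Rmin ea (Rmin e1 (Rmin a1 (Rmin (a - a1) (Rmin (a2 - a) (1 - a2)))))) / 2).
    (* The nested minima are unfolded from the innermost outwards, each proved positive and then
       replaced by a variable. *)
    repeat (match goal with |- context [Rmin ?x ?y] =>
      lazymatch y with context [Rmin _ _] => fail | _ =>
        let z := fresh "z" in
        pose proof (Rmin_l x y); pose proof (Rmin_r x y);
        assert (0 < Rmin x y) by (apply Rmin_glb_lt; lra);
        set (z := Rmin x y) in * end end).
    lra. }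
  destruct Hdel as [del [? [? [? [? [? [? [? ?]]]]]]]].
  exists del, m; repeat (split; [assumption|]); split; [|split].
  - intros x Hx; destruct (Rabs_def2 (g' x - g' 0) m); [|lra].
    apply D0; [lra | apply Rabs_def1; lra].
  - intros x Hx; destruct (Rabs_def2 (g' x - g' a) m); [|lra].
    apply Da; [lra | apply Rabs_def1; lra].
  - intros x Hx; destruct (Rabs_def2 (g' x - g' 1) m); [|lra].
    apply D1; [lra | apply Rabs_def1; lra].
Qed.

Lemma bistable_cell_slope (a a1 a2 del m : R) (g g' : R -> R) (s : symbol) (x y : R) :
  bistable a a1 a2 g g' -> 0 < del ->
  del < a1 -> del < a - a1 -> del < a2 - a -> del < 1 - a2 ->
  (forall x, 0 <= x <= del -> g' x <= - m) ->
  (forall x, a - del <= x <= a + del -> m <= g' x) ->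
  (forall x, 1 - del <= x <= 1 -> g' x <= - m) ->
  cell_lo a del s <= x -> x <= y -> y <= cell_hi a del s ->
  m * (y - x) <= - orientation s * (g y - g x).
Proof.
  intros [HC [_ [Ha _]]] Hd ? ? ? ? S0 Sa S1 Hx Hxy Hy.
  destruct s; simpl in *.
  - pose proof (C1_unit_increment_le g g' (- m) x y HC ltac:(lra) Hxy ltac:(lra)
      ltac:(intros c ?; apply S0; lra)); lra.
  - pose proof (C1_unit_increment_ge g g' m x y HC ltac:(lra) Hxy ltac:(lra)
      ltac:(intros c ?; apply Sa; lra)); lra.
  - pose proof (C1_unit_increment_le g g' (- m) x y HC ltac:(lra) Hxy ltac:(lra)
      ltac:(intros c ?; apply S1; lra)); lra.
Qed.

Lemma bistable_expanding_branches (a a1 a2 : R) (g g' : R -> R) :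
  bistable a a1 a2 g g' ->
  exists d0 del, 0 < d0 /\ 0 < del /\
    del < a1 /\ del < a - a1 /\ del < a2 - a /\ del < 1 - a2 /\
    forall d, 0 < d < d0 ->
    exists phi, expanding_branches (h g d) (cell_lo a del) (cell_hi a del) phi.
Proof.
  intros Hb.
  destruct (bistable_slopes a a1 a2 g g' Hb)
    as [del [m [Hdel [Hm [d1 [d2 [d3 [d4 [S0 [Sa S1]]]]]]]]]].
  pose proof (fun s x y => bistable_cell_slope a a1 a2 del m g g' s x y
                Hb Hdel d1 d2 d3 d4 S0 Sa S1) as Hslope.
  destruct Hb as [HC [[g0 [ga g1]] [Ha [Hneg Hpos]]]].
  assert (Hmd : 0 < m * del) by (apply Rmult_lt_0_compat; assumption).
  (* For such [d], [m * del > 6 * d], which pushes [h] out of [0,2] at the cell ends other than 0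
     and 1. As [del < 1], also [6 * d < m]: the term [g / d] has slope at least 6 in size, and the
     term [2 * u] costs at most 2 of it, on the middle branch, leaving 4. *)
  exists (m * del / 6), del.
  split; [lra|]; do 5 (split; [assumption|]).
  intros d Hd.
  assert (Hd6 : 6 * d < m) by nra.
  assert (Hh : forall u, h g d u = 2 * u - g u / d) by (intros u; unfold h; field; lra).
  assert (Hlow : forall u, g u <= - (2 * d) -> 2 * u + 2 <= h g d u).
  { intros u Hu; rewrite Hh.
    pose proof (Rle_div_of_mul_le 2 (- g u) d ltac:(lra) ltac:(lra)).
    unfold Rdiv in *; lra. }
  assert (Hhigh : forall u, 2 * d <= g u -> h g d u <= 2 * u - 2).
  { intros u Hu; rewrite Hh.
    pose proof (Rle_div_of_mul_le 2 (g u) d ltac:(lra) ltac:(lra)); lra. }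
  pose proof (Hslope sym0 0 del ltac:(simpl; lra) ltac:(lra) ltac:(simpl; lra)) as V0.
  pose proof (Hslope syma (a - del) a ltac:(simpl; lra) ltac:(lra) ltac:(simpl; lra)) as Va.
  pose proof (Hslope syma a (a + del) ltac:(simpl; lra) ltac:(lra) ltac:(simpl; lra)) as Va'.
  pose proof (Hslope sym1 (1 - del) 1 ltac:(simpl; lra) ltac:(lra) ltac:(simpl; lra)) as V1.
  simpl in V0, Va, Va', V1.
  (* The statement is made total over pairs so that one choice principle defines [phi]; for [t]
     outside [0,2] the witness 0 is a dummy. *)
  assert (Hex : forall p : symbol * R, exists x, 0 <= snd p <= 2 ->
            cell_lo a del (fst p) <= x <= cell_hi a del (fst p) /\ h g d x = snd p).
  { intros [s t]; simpl.
    destruct (classic (0 <= t <= 2)) as [Ht|Ht]; [|exists 0; tauto].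
    set (G := fun x => 2 * x - g (clamp x) / d).
    assert (HG : continuity G).
    { intros x; unfold G, Rdiv.
      apply continuity_pt_minus; [|apply continuity_pt_mult].
      - apply continuity_pt_mult; [apply continuity_pt_const; intros ? ?; reflexivity|].
        apply derivable_continuous_pt, derivable_pt_id.
      - exact (C1_unit_clamp_continuity g g' HC x).
      - apply continuity_pt_const; intros ? ?; reflexivity. }
    assert (GE : forall x, 0 <= x <= 1 -> G x = h g d x)
      by (intros x Hx; unfold G; rewrite clamp_id, Hh by exact Hx; reflexivity).
    destruct (IVT_between G (cell_lo a del s) (cell_hi a del s) t HG) as [x [Hx E]].
    - destruct s; simpl; lra.
    - destruct s; simpl; rewrite !GE by lra.
      + left; pose proof (Hlow del ltac:(lra)); rewrite (Hh 0), g0; lra.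
      + right; pose proof (Hlow (a - del) ltac:(lra));
          pose proof (Hhigh (a + del) ltac:(lra)); lra.
      + left; pose proof (Hhigh (1 - del) ltac:(lra)); rewrite (Hh 1), g1; lra.
    - exists x; intros _; split; [exact Hx|].
      rewrite <- E, GE; [reflexivity | destruct s; simpl in Hx; lra]. }
  set (phi := fun s t => proj1_sig (constructive_indefinite_description _ (Hex (s, t)))).
  exists phi; constructor; simpl; try lra.
  - intros u Hu Hhu.
    destruct (Rle_lt_dec u del); [exists sym0; simpl; lra|].
    destruct (Rle_lt_dec (1 - del) u); [exists sym1; simpl; lra|].
    destruct (Rlt_le_dec u (a - del)) as [Hua|Hua].
    (* Between the left and middle cells [g] decreases up to [a1] and then increases, so it is
       bounded by its value at one of the ends, at most [- (m * del)]; then [h] exceeds 2. *)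
    { exfalso.
      assert (g u <= - (2 * d)); [|pose proof (Hlow u); lra].
      destruct (Rle_lt_dec u a1).
      - pose proof (C1_unit_increment_le g g' 0 del u HC ltac:(lra) ltac:(lra) ltac:(lra)
          ltac:(intros c ?; left; apply Hneg; lra)); lra.
      - pose proof (C1_unit_increment_ge g g' 0 u (a - del) HC ltac:(lra) ltac:(lra) ltac:(lra)
          ltac:(intros c ?; left; apply Hpos; lra)); lra. }
    destruct (Rle_lt_dec u (a + del)); [exists syma; simpl; lra|].
    exfalso.
    (* The mirror case: [g] rises up to [a2] and then falls, so it stays above one of its end
       values, and [h] is negative. *)
    assert (2 * d <= g u); [|pose proof (Hhigh u); lra].
    destruct (Rle_lt_dec u a2).
    + pose proof (C1_unit_increment_ge g g' 0 (a + del) u HC ltac:(lra) ltac:(lra) ltac:(lra)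
        ltac:(intros c ?; left; apply Hpos; lra)); lra.
    + pose proof (C1_unit_increment_le g g' 0 u (1 - del) HC ltac:(lra) ltac:(lra) ltac:(lra)
        ltac:(intros c ?; left; apply Hneg; lra)); lra.
  - intros s x y Hx Hxy Hy; pose proof (Hslope s x y Hx Hxy Hy) as Hs.
    rewrite !Hh.
    assert (6 * (y - x) <= - orientation s * (g y - g x) / d).
    { apply Rle_div_of_mul_le; [lra|]; nra. }
    replace (orientation s * (2 * y - g y / d - (2 * x - g x / d)))
      with (orientation s * (2 * (y - x)) + - orientation s * (g y - g x) / d) by (field; lra).
    destruct s; simpl in *; lra.
  - intros s t Ht; unfold phi.
    destruct (constructive_indefinite_description _ (Hex (s, t))) as [x Hx]; simpl in *; auto.
  - rewrite Hh, g0; lra.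
  - rewrite Hh, g1; lra.
Qed.

(** * Level roots and strips *)

(** The levels run 2, 1, 0 on the middle branch because [H] decreases there. *)
Definition branch_roots (phi : symbol -> R -> R) (k : nat) : R :=
  match k with
  | 0%nat => phi sym0 0 | 1%nat => phi sym0 1 | 2%nat => phi sym0 2
  | 3%nat => phi syma 2 | 4%nat => phi syma 1 | 5%nat => phi syma 0
  | 6%nat => phi sym1 0 | 7%nat => phi sym1 1 | _ => phi sym1 2
  end.

Lemma branch_inverse_monotone (H : R -> R) (lo hi : symbol -> R)
    (phi : symbol -> R -> R) (s : symbol) (t t' : R) :
  expanding_branches H lo hi phi -> 0 <= t -> t <= t' -> t' <= 2 ->
  0 <= orientation s * (phi s t' - phi s t).
Proof.
  intros EB Ht Htt Ht'.
  destruct (eb_phi _ _ _ _ EB s t ltac:(lra)) as [Hp Ep].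
  destruct (eb_phi _ _ _ _ EB s t' ltac:(lra)) as [Hp' Ep'].
  destruct (Rle_dec (phi s t) (phi s t')) as [Hle|Hle].
  - pose proof (eb_expand _ _ _ _ EB s (phi s t) (phi s t') ltac:(lra) ltac:(lra) ltac:(lra)) as He.
    rewrite Ep, Ep' in He; destruct s; simpl in *; lra.
  - pose proof (eb_expand _ _ _ _ EB s (phi s t') (phi s t) ltac:(lra) ltac:(lra) ltac:(lra)) as He.
    rewrite Ep, Ep' in He; destruct s; simpl in *; lra.
Qed.

Lemma branch_inverse_strict (H : R -> R) (lo hi : symbol -> R)
    (phi : symbol -> R -> R) (s : symbol) (t t' : R) :
  expanding_branches H lo hi phi -> 0 <= t -> t < t' -> t' <= 2 ->
  0 < orientation s * (phi s t' - phi s t).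
Proof.
  intros EB Ht Htt Ht'.
  destruct (branch_inverse_monotone H lo hi phi s t t' EB) as [|E]; try lra.
  assert (E' : phi s t' = phi s t) by (destruct s; simpl in E; lra).
  destruct (eb_phi _ _ _ _ EB s t ltac:(lra)) as [_ Ep].
  destruct (eb_phi _ _ _ _ EB s t' ltac:(lra)) as [_ Ep'].
  rewrite E' in Ep'; lra.
Qed.

Lemma branch_level_set (H : R -> R) (lo hi : symbol -> R)
    (phi : symbol -> R -> R) (t u : R) :
  expanding_branches H lo hi phi -> 0 <= t <= 2 -> 0 <= u <= 1 ->
  (H u = t <-> u = phi sym0 t \/ u = phi syma t \/ u = phi sym1 t).
Proof.
  intros EB Ht Hu; split.
  - intros E; destruct (eb_cover _ _ _ _ EB u Hu ltac:(lra)) as [s Hs].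
    pose proof (branch_inverse_unique _ _ _ _ EB s u t Ht Hs E).
    destruct s; auto.
  - intros [-> | [-> | ->]]; apply (eb_phi _ _ _ _ EB _ t Ht).
Qed.

Lemma branch_roots_level_roots (g : R -> R) (d : R) (lo hi : symbol -> R)
    (phi : symbol -> R -> R) :
  expanding_branches (h g d) lo hi phi -> level_roots g d (branch_roots phi).
Proof.
  intros EB.
  pose proof (branch_lo_le_hi _ _ _ _ EB) as Hlh.
  pose proof (eb_lo0 _ _ _ _ EB); pose proof (eb_gap0 _ _ _ _ EB).
  pose proof (eb_gap1 _ _ _ _ EB); pose proof (eb_hi1 _ _ _ _ EB).
  unfold level_roots; repeat split; simpl.
  1,3,5: intros E; apply (branch_level_set _ _ _ _ _ _ EB) in E; try lra; tauto.
  1,2,3: intros E; apply (branch_level_set _ _ _ _ _ _ EB); try lra; tauto.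
  - symmetry; apply (branch_inverse_unique _ _ _ _ EB); [lra | | exact (eb_H0 _ _ _ _ EB)].
    pose proof (Hlh sym0); lra.
  - symmetry; apply (branch_inverse_unique _ _ _ _ EB); [lra | | exact (eb_H1 _ _ _ _ EB)].
    pose proof (Hlh sym1); lra.
  (* Within a branch the order comes from strict monotonicity, across branches from the gaps between
     cells. *)
  - pose proof (fun s => branch_inverse_strict _ _ _ _ s 0 1 EB ltac:(lra) ltac:(lra) ltac:(lra)) as P01.
    pose proof (fun s => branch_inverse_strict _ _ _ _ s 1 2 EB ltac:(lra) ltac:(lra) ltac:(lra)) as P12.
    pose proof (P01 sym0); pose proof (P01 syma); pose proof (P01 sym1).
    pose proof (P12 sym0); pose proof (P12 syma); pose proof (P12 sym1).
    destruct (eb_phi _ _ _ _ EB sym0 2 ltac:(lra)).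
    destruct (eb_phi _ _ _ _ EB syma 2 ltac:(lra)).
    destruct (eb_phi _ _ _ _ EB syma 0 ltac:(lra)).
    destruct (eb_phi _ _ _ _ EB sym1 0 ltac:(lra)).
    simpl in *.
    intros k Hk; do 8 (destruct k as [|k]; [simpl; lra|]); lia.
Qed.

(** Since [h] at u_i minus u_(i+1) is u_(i-1), the strip inequality says that u_(i-1) lies in [0,1].
    The range of y follows because u_i lies between [phi (s i) 0] and [phi (s i) 2]. *)
Lemma coded_corresponds (g : R -> R) (d : R) (lo hi : symbol -> R)
    (phi : symbol -> R -> R) (s : Z -> symbol) (u : Z -> R) :
  expanding_branches (h g d) lo hi phi -> coded phi s u ->
  corresponds g d (branch_roots phi) u s.
Proof.
  intros EB Hu i.
  destruct (Hu (i - 1)%Z) as [Hm _], (Hu (i + 1)%Z) as [Hp _], (Hu i) as [Hi Ei].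
  destruct (coded_equation _ _ _ _ EB s u Hu i) as [_ Eh].
  split; [auto|]; split; [|lra].
  set (t := u (i - 1)%Z + u (i + 1)%Z) in *.
  assert (Ht : 0 <= t <= 2) by (unfold t; lra).
  pose proof (branch_inverse_monotone _ _ _ _ (s i) 0 t EB ltac:(lra) ltac:(lra) ltac:(lra)).
  pose proof (branch_inverse_monotone _ _ _ _ (s i) t 2 EB ltac:(lra) ltac:(lra) ltac:(lra)).
  rewrite <- Ei in *; destruct (s i); simpl in *; lra.
Qed.

(** * Fronts from codings, and their classification *)

Lemma stationary_equation (g : R -> R) (d : R) (u : Z -> R) (i : Z) :
  0 < d ->
  (d * (u (i - 1)%Z - 2 * u i + u (i + 1)%Z) + g (u i) = 0 <->
   h g d (u i) = u (i - 1)%Z + u (i + 1)%Z).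
Proof.
  intros Hd; unfold h; split; intros E.
  - replace (g (u i)) with (- d * (u (i - 1)%Z - 2 * u i + u (i + 1)%Z)) by lra; field; lra.
  - replace (u (i - 1)%Z - 2 * u i + u (i + 1)%Z) with (- (1 / d * g (u i))) by lra; field; lra.
Qed.

Lemma coded_increasing_front (g : R -> R) (d : R) (lo hi : symbol -> R)
    (phi : symbol -> R -> R) (s : Z -> symbol) (u : Z -> R) :
  0 < d -> expanding_branches (h g d) lo hi phi -> coded phi s u ->
  (forall i, (i < 0)%Z -> s i = sym0) -> (forall i, (0 < i)%Z -> s i = sym1) ->
  increasing_front g d u.
Proof.
  intros Hd EB Hu Hs0 Hs1; split; [|exact (coded_front _ _ _ _ s u EB Hu Hs0 Hs1)].
  split; [apply Hu|]; intros i.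
  apply stationary_equation; [exact Hd|]; apply (coded_equation _ _ _ _ EB s u Hu).
Qed.

(** A shift of [u] with the coding of [v] equals [v] by uniqueness; undoing the shift gives
    [- m]. *)
Lemma translation_of_coded (H : R -> R) (lo hi : symbol -> R)
    (phi : symbol -> R -> R) (s : Z -> symbol) (u v : Z -> R) (m : Z) :
  expanding_branches H lo hi phi -> coded phi s v ->
  coded phi s (fun i => u (i + m)%Z) -> translation_of v u.
Proof.
  intros EB Hv Hu; exists (- m)%Z; intros i.
  pose proof (coded_unique _ _ _ _ EB s _ _ Hu Hv (i + - m)%Z) as E; simpl in E.
  rewrite <- E; f_equal; lia.
Qed.

Lemma sbar_neg (i : Z) : (i < 0)%Z -> sbar i = sym0.
Proof. unfold sbar; destruct (Z.ltb_spec i 0); [reflexivity | lia]. Qed.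

Lemma sbar_pos (i : Z) : (0 < i)%Z -> sbar i = sym1.
Proof. unfold sbar; destruct (Z.ltb_spec i 0); [lia | reflexivity]. Qed.

Lemma shat_neg (i : Z) : (i < 0)%Z -> shat i = sym0.
Proof. unfold shat; destruct (Z.ltb_spec i 0); [reflexivity | lia]. Qed.

Lemma shat_pos (i : Z) : (0 < i)%Z -> shat i = sym1.
Proof.
  unfold shat; destruct (Z.ltb_spec i 0); [lia|].
  destruct (Z.eqb_spec i 0); [lia | reflexivity].
Qed.

Theorem theorem2 (a a1 a2 : R) (g g' : R -> R)
  (ha : 0 < a < 1) (hg : bistable a a1 a2 g g') :
  exists d0 : R, 0 < d0 /\
  forall d : R, 0 < d < d0 ->
  exists r : nat -> R, level_roots g d r /\
  exists ubar uhat : Z -> R,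
    increasing_front g d ubar /\
    increasing_front g d uhat /\
    ~ translation_of ubar uhat /\
    (forall u : Z -> R, increasing_front g d u ->
       translation_of ubar u \/ translation_of uhat u) /\
    ((exists s : Z -> symbol,
        translation_of sbar s /\ corresponds g d r ubar s) /\
     (forall i : Z, 0 <= ubar i < a1 \/ a2 < ubar i <= 1)) /\
    (exists s : Z -> symbol,
       translation_of shat s /\ corresponds g d r uhat s /\
       exists i : Z, s i = syma /\
         unique (fun j : Z => a1 < uhat j < a2) i).
Proof.
  destruct (bistable_expanding_branches a a1 a2 g g' hg)
    as [d0 [del [Hd0 [Hdel [d1 [d2 [d3 [d4 Hbr]]]]]]]].
  exists d0; split; [exact Hd0|]; intros d Hd.
  destruct (Hbr d Hd) as [phi EB].
  exists (branch_roots phi); split; [exact (branch_roots_level_roots _ _ _ _ _ EB)|].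
  destruct (coded_exists _ _ _ _ EB sbar) as [ubar Hbar].
  destruct (coded_exists _ _ _ _ EB shat) as [uhat Hhat].
  assert (Rbar : forall i, 0 <= ubar i < a1 \/ a2 < ubar i <= 1).
  { intros i; destruct (coded_equation _ _ _ _ EB _ _ Hbar i) as [Hr _].
    unfold sbar in Hr; destruct (i <? 0)%Z; simpl in Hr; lra. }
  assert (Rhat : a1 < uhat 0%Z < a2).
  { destruct (coded_equation _ _ _ _ EB _ _ Hhat 0%Z) as [Hr _]; simpl in Hr; lra. }
  exists ubar, uhat; split; [|split; [|split; [|split; [|split; [split|]]]]].
  - exact (coded_increasing_front _ _ _ _ _ _ _ (proj1 Hd) EB Hbar sbar_neg sbar_pos).
  - exact (coded_increasing_front _ _ _ _ _ _ _ (proj1 Hd) EB Hhat shat_neg shat_pos).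
  (* A translate of [ubar] avoids the interval between [a1] and [a2], which contains [uhat 0]. *)
  - intros [k Hk]; specialize (Hk 0%Z); destruct (Rbar (0 + k)%Z); lra.
  - intros u [[Hunit He] [L0 [L1 Hm]]].
    destruct (monotone_front_coding _ _ _ _ u EB Hunit) as [m [Hc|Hc]]; auto.
    + intros i; apply stationary_equation; [lra | apply He].
    + left; exact (translation_of_coded _ _ _ _ _ _ _ m EB Hbar Hc).
    + right; exact (translation_of_coded _ _ _ _ _ _ _ m EB Hhat Hc).
  - exists sbar; split; [exists 0%Z; intros i; f_equal; lia|].
    exact (coded_corresponds _ _ _ _ _ _ _ EB Hbar).
  - exact Rbar.
  - exists shat; split; [exists 0%Z; intros i; f_equal; lia|].
    split; [exact (coded_corresponds _ _ _ _ _ _ _ EB Hhat)|].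
    exists 0%Z; split; [reflexivity|]; split; [exact Rhat|].
    (* Away from index 0 the terms of [uhat] lie in the outer cells, which miss the interval between
       [a1] and [a2]. *)
    intros j Hj; destruct (Z.lt_trichotomy 0 j) as [Hlt|[E|Hlt]]; [|exact E|];
      destruct (coded_equation _ _ _ _ EB _ _ Hhat j) as [Hr _].
    + rewrite shat_pos in Hr by exact Hlt; simpl in Hr; lra.
    + rewrite shat_neg in Hr by exact Hlt; simpl in Hr; lra.
Qed.
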